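(* For every $d\ge2$, the number of similarity classes of $d$-dimensional perfect lattices is at most $$I_d^{\,d+1}\binom{3^dI_d}{\binom d2}.$$
   Context: A $d$-dimensional Euclidean lattice $\Lambda$ is perfect if $\{v\otimes v\}$, $v$ ranging over its minimal vectors (nonzero vectors of minimal length), spans the $\binom{d+1}{2}$-dimensional space of symmetric tensors in $(\Lambda\otimes\mathbb R)^{\otimes2}$. A lattice is well-rounded if its minimal vectors span $\Lambda\otimes\mathbb R$. $I_d$ is the smallest integer such that whenever $\Lambda$ is a $d$-dimensional lattice and $\Lambda'\subseteq\Lambda$ is a $d$-dimensional well-rounded sublattice whose minimal vectors are all minimal vectors of $\Lambda$, the index $[\Lambda:\Lambda']$ is at most $I_d$. *)

(* Defs.v *)
From Stdlib Require Import Reals ZArith.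
From mathcomp Require Import ssreflect ssrfun ssrbool eqtype ssrnat seq fintype bigop binomial.
Set Implicit Arguments. Unset Strict Implicit.

Definition vec (d : nat) := 'I_d -> R.

Definition dot {d : nat} (u v : vec d) : R :=
  \big[Rplus/0%R]_(j < d) (u j * v j)%R.

Definition vsub {d : nat} (u v : vec d) : vec d := fun j => (u j - v j)%R.

Definition vzero {d : nat} : vec d := fun _ => 0%R.

Definition zcomb {d : nat} (b : 'I_d -> vec d) (z : 'I_d -> Z) : vec d :=
  fun j => \big[Rplus/0%R]_(i < d) (IZR (z i) * b i j)%R.

Definition is_lattice {d : nat} (L : vec d -> Prop) : Prop :=
  exists b : 'I_d -> vec d,
    (forall r : 'I_d -> R,
        (forall j, \big[Rplus/0%R]_(i < d) (r i * b i j)%R = 0%R) ->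
        forall i, r i = 0%R) /\
    (forall v, L v <-> exists z, v = zcomb b z).

Definition min_vec {d : nat} (L : vec d -> Prop) (v : vec d) : Prop :=
  L v /\ v <> @vzero d /\
  (forall w, L w -> w <> @vzero d -> (dot v v <= dot w w)%R).

Definition perfect {d : nat} (L : vec d -> Prop) : Prop :=
  forall S : 'I_d -> 'I_d -> R,
    (forall i j, S i j = S j i) ->
    exists cs : seq (R * vec d),
      (forall p, List.In p cs -> min_vec L p.2) /\
      (forall i j, S i j = \big[Rplus/0%R]_(p <- cs) (p.1 * p.2 i * p.2 j)%R).

Definition well_rounded {d : nat} (L : vec d -> Prop) : Prop :=
  forall x : vec d,
    exists cs : seq (R * vec d),
      (forall p, List.In p cs -> min_vec L p.2) /\
      (forall j, x j = \big[Rplus/0%R]_(p <- cs) (p.1 * p.2 j)%R).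

Definition lattice_index {d : nat} (L L' : vec d -> Prop) (n : nat) : Prop :=
  exists reps : 'I_n -> vec d,
    (forall k, L (reps k)) /\
    (forall v, L v -> exists! k, L' (vsub v (reps k))).

Definition index_bound (d k : nat) : Prop :=
  forall (L L' : vec d -> Prop) (n : nat),
    is_lattice L -> is_lattice L' ->
    (forall v, L' v -> L v) ->
    well_rounded L' ->
    (forall v, min_vec L' v -> min_vec L v) ->
    lattice_index L L' n -> (n <= k)%N.

Definition is_I (d k : nat) : Prop :=
  index_bound d k /\ (forall k', index_bound d k' -> (k <= k')%N).

Definition similar {d : nat} (L1 L2 : vec d -> Prop) : Prop :=
  exists (c : R) (O : 'I_d -> 'I_d -> R),
    (0 < c)%R /\
    (forall i j, \big[Rplus/0%R]_(k < d) (O i k * O j k)%R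
                 = (if i == j then 1%R else 0%R)) /\
    (forall v, L2 v <->
       exists u, L1 u /\ v = (fun j => c * \big[Rplus/0%R]_(i < d) (u i * O i j))%R).

(* Main.v *)
(* Let L be a perfect lattice. Among all bases of L and all d-tuples of linearly
   independent minimal vectors, written as integer matrices A in the basis,
   choose one with |det A| maximal; |det A| is the index of a well-rounded
   sublattice, hence at most I_d. A change of basis multiplies A on the right by
   a unimodular matrix, so A may be taken in a fixed list of I_d^d triangular
   matrices T. By Cramer's rule every minimal vector has coordinates in [-1, 1]
   with respect to the rows of T, and at most 3^d |det T| integer vectors do.
   Perfection supplies C(d, 2) minimal vectors whose squares, together with the
   squares of the rows of T, form a basis of the symmetric tensors; since all of
   these vectors have the same norm, they determine the Gram matrix of L up to
   scaling. So T and this set of C(d, 2) vectors determine the similarity class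
   of L. *)

From Stdlib Require Import Reals ZArith.
From mathcomp Require Import all_boot all_order all_algebra.
From mathcomp Require Import boolp Rstruct.
From mathcomp Require Import ssrZ zify ring.
(* Loaded last: mathcomp also defines a notion called [similar]. *)
Require Import Defs.

Set Implicit Arguments. Unset Strict Implicit. Unset Printing Implicit Defensive.

Import Order.TTheory GRing.Theory Num.Theory.
Local Open Scope ring_scope.

(** * Integer matrices *)

Lemma absz_det_unitmx d (U : 'M[int]_d) : U \in unitmx -> `|\det U|%N = 1%N.
Proof. by rewrite unitmxE => /orP[] /eqP ->. Qed.

(** With the Smith normal form [A = L *m D *m S], the coordinates given by [S] turn the row lattice
    into multiples of the diagonal entries of [D]. The box of residues modulo these entries has
    [|det A|] points. *)
Lemma row_lattice_reps d (A : 'M[int]_d) : \det A != 0 ->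
  exists reps : 'I_`|\det A| -> 'rV[int]_d,
    forall z, exists! k, exists y, z - reps k = y *m A.
Proof.
move=> A0.
have [L uL [S uS [s _ defA]]] := int_Smith_normal_form A.
set D := (\matrix_(i, j) _) in defA.
have defD : D = diag_mx (\row_(i < d) s`_i).
  by apply/matrixP => i j; rewrite !mxE.
have detA : `|\det A|%N = (\prod_(i < d) `|(s`_i)%R|)%N.
  rewrite defA !det_mulmx defD det_diag !abszM !absz_det_unitmx // mul1n muln1.
  rewrite (big_morph absz abszM (erefl : `|1%R|%N = 1%N)).
  by apply: eq_bigr => i _; rewrite mxE.
have s0 (i : 'I_d) : s`_i != 0.
  apply: contraNneq A0 => si0.
  by rewrite -absz_eq0 detA (bigD1 i) //= si0 mul0n.
pose X := {dffun forall i : 'I_d, 'I_`|(s`_i)%R|}.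
have cardX : #|X| = `|\det A|%N.
  rewrite card_dep_ffun foldrE big_image detA.
  by apply: eq_bigr => i _; rewrite card_ord.
rewrite -cardX; pose x (k : 'I_#|X|) := \row_(i < d) (enum_val k i : nat)%:Z.
exists (fun k => x k *m S) => z.
have [w ->] : exists w, z = w *m S by exists (z *m invmx S); rewrite mulmxKV.
have wlt i : (`|(w ord0 i %% s`_i)%Z| < `|(s`_i)%R|)%N.
  by rewrite -ltz_nat gez0_abs ?modz_ge0 // abszE ltz_mod.
pose r : X := [ffun i : 'I_d => Ordinal (wlt i)].
exists (enum_rank r); split.
  exists ((\row_i (w ord0 i %/ s`_i)%Z) *m invmx L).
  rewrite defA mulmxA mulmxA mulmxKV // -mulmxBl.
  congr (_ *m _); rewrite defD mul_mx_diag; apply/rowP => i.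
  rewrite !mxE enum_rankK ffunE /= gez0_abs ?modz_ge0 //.
  apply/eqP; rewrite subr_eq; apply/eqP; exact: divz_eq.
move=> k [y]; rewrite -mulmxBl defA !mulmxA.
move/(can_inj (mulmxK uS)); rewrite defD mul_mx_diag => /rowP eqw.
apply: enum_val_inj; rewrite enum_rankK; apply/ffunP => i; apply: val_inj.
rewrite ffunE /=; apply/eqP; rewrite -eqz_nat gez0_abs ?modz_ge0 //.
have /eqP := eqw i; rewrite !mxE subr_eq addrC => /eqP ->.
by rewrite addrC modzMDl -modz_abs modz_small // ltz_nat ltn_ord.
Qed.

(** The Smith normal form of the top row alone has at most one nonzero entry, and its right factor
    supplies the column operations. *)
Lemma clear_first_row d (A : 'M[int]_(1 + d)) :
  exists2 U, U \in unitmx &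
  exists (t : nat) x A', A *m U = block_mx (t%:Z)%:M 0 x A'.
Proof.
have [L _ [S uS [s _ defA]]] := int_Smith_normal_form (usubmx A).
set D := (\matrix_(i, j) _) in defA.
set B := A *m invmx S.
have B0 : ursubmx B = 0.
  have BE : usubmx B = L *m D by rewrite /B -mul_usub_mx defA mulmxK.
  apply/matrixP => i j; rewrite -[ursubmx B]/(rsubmx (usubmx B)) BE !mxE.
  rewrite big_ord_recl big_ord0 !mxE [i]ord1 /= !ord1 /=; ring.
(* The corner [b] may be negative; scaling by its sign [c] keeps the operations unimodular and makes
   the corner a natural number. *)
pose b := ulsubmx B 0 0; pose c : int := (-1) ^+ (b < 0)%R.
exists (c *: invmx S).
  rewrite unitmxE detZ unitrM -unitmxE unitmx_inv uS andbT.
  by rewrite unitrX // unitrX // unitrN1.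
exists `|b|%N, (c *: dlsubmx B), (c *: drsubmx B).
rewrite -scalemxAr -/B -[in LHS](submxK B) B0 scale_block_mx scaler0.
congr block_mx; apply/matrixP=> i j; rewrite !ord1 [RHS]mxE mulr1n mxE.
by rewrite abszEsign.
Qed.

(* Up to unimodular column operations, A = [[t, 0], [x, T]] with T in the list for
   dimension d and x in a fixed system of |det T| representatives of Z^d modulo
   the columns of T. The number (t - 1) |det T| + (index of x) is smaller than
   |det A| <= I and determines t and x, so each new dimension costs a factor
   I. *)
Lemma hermite_cover d I :
  exists2 s : seq 'M[int]_d, size s = (I ^ d)%N &
    forall A, (0 < `|\det A| <= I)%N ->
    exists2 U, U \in unitmx & A *m U \in s.
Proof.
elim: d => [|d [s sizes IHs]].
  exists [:: 0]; rewrite ?expn0 // => A _; exists 1%:M; rewrite ?unitmx1 //.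
  by rewrite inE; apply/eqP/matrixP; case.
rewrite -[d.+1]/(1 + d)%N.
(* Representatives modulo the columns of [T], whence the transposes below, extended by 0 to all
   natural numbers. *)
have /choice[f fP] (T : 'M[int]_d) : exists f : nat -> 'cV[int]_d,
    \det T != 0 -> forall x, exists2 k, (k < `|\det T|)%N &
    exists y, x - f k = T *m y.
  have [->|T0] := eqVneq (\det T) 0; first by exists (fun=> 0).
  have [|reps repsP] := @row_lattice_reps _ T^T; first by rewrite det_tr.
  rewrite det_tr in reps repsP.
  exists (fun k => if insub k is Some k' then (reps k')^T else 0) => _ x.
  have [k [[y yE] _]] := repsP x^T; exists k => //; exists y^T.
  by rewrite valK; apply: trmx_inj; rewrite linearB /= trmxK yE trmx_mul trmxK.
exists [seq block_mx ((k %/ `|\det T|).+1%:Z)%:M 0 (f T (k %% `|\det T|)%N) T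
         | T <- s, k <- iota 0 I].
  by rewrite size_allpairs size_iota sizes add1n expnSr.
move=> A; have [U uU [t [x [A' defAU]]]] := clear_first_row A.
have -> : `|\det A|%N = (t * `|\det A'|)%N.
  move/(congr1 (fun B => absz (\det B))): defAU.
  by rewrite det_lblock det_scalar1 det_mulmx !abszM (absz_det_unitmx uU) muln1.
rewrite muln_gt0 => /andP[/andP[t0 dA'0] tA'I].
have [|V uV sV] := IHs A'.
  by rewrite dA'0 (leq_trans _ tA'I) // leq_pmull.
set T := A' *m V in sV.
have dT : `|\det T|%N = `|\det A'|%N.
  by rewrite det_mulmx abszM (absz_det_unitmx uV) muln1.
have [|k kT [y yE]] := fP T _ x; first by rewrite -absz_gt0 dT.
(* The lower left block subtracts [T *m y] from [x], leaving the representative [f T k]. *)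
pose W : 'M[int]_(1 + d) := block_mx 1%:M 0 (- (V *m y)) V.
have uW : W \in unitmx by rewrite unitmxE det_lblock det1 mul1r -unitmxE.
exists (U *m W); first by rewrite unitmx_mul uU uW.
have -> : A *m (U *m W) = block_mx (t%:Z)%:M 0 (f T k) T.
  rewrite mulmxA defAU /W mulmx_block !mulmx1 !mul0mx !mulmx0 !addr0 add0r.
  by congr block_mx; rewrite mulmxN mulmxA -/T -yE opprB addrC subrK.
apply/allpairsPdep; exists T, (t.-1 * `|\det T| + k)%N; split => //=.
  rewrite mem_iota add0n (leq_trans _ tA'I) // -dT -[X in (_ < X * _)%N](prednK t0).
  by rewrite mulSn addnC ltn_add2r.
by rewrite divnMDl ?modnMDl ?(leq_ltn_trans _ kT) // divn_small // modn_small // addn0 prednK.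
Qed.

(* z is coded by its class modulo the rows of A and by the residues mod 3 of the
   remaining integer coordinates: for two points of the parallelepiped in the same
   class, these coordinates differ by at most 2. The coordinates of z with respect
   to the rows of A are the entries of [z *m \adj A] divided by [\det A]. *)
Lemma parallelepiped_code d I (A : 'M[int]_d) : (0 < `|\det A| <= I)%N ->
  exists phi : 'rV[int]_d -> 'I_I * {ffun 'I_d -> 'I_3},
    {in [pred z | [forall i, `|(z *m \adj A) 0 i| <= `|\det A|]] &,
      injective phi}.
Proof.
case/andP=> A0 AI; rewrite absz_gt0 in A0.
have [reps repsP] := row_lattice_reps A0.
have /choice[ky kyP] z : exists ky, z = reps ky.1 + ky.2 *m A.
  have [k [[y yE] _]] := repsP z; exists (k, y); rewrite -yE /=.
  by rewrite addrC subrK.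
have m3 (z : int) : (`|(z %% 3)%Z| < 3)%N.
  by rewrite -ltz_nat gez0_abs ?modz_ge0 // (@ltz_mod z 3).
exists (fun z => (widen_ord AI (ky z).1,
                  [ffun i => Ordinal (m3 ((ky z).2 0 i))])) => z z'.
rewrite !inE => /forallP zP /forallP z'P [kE /ffunP yE].
have {}kE : (ky z).1 = (ky z').1 by apply: val_inj.
suff yzz' : (ky z).2 = (ky z').2 by rewrite (kyP z) (kyP z') kE yzz'.
apply/rowP => i; set y := (ky z).2; set y' := (ky z').2.
have zz' : (z - z') *m \adj A = \det A *: (y - y').
  rewrite {1}(kyP z) {1}(kyP z') kE -/y -/y' opprD addrACA subrr add0r.
  by rewrite -mulmxBl -mulmxA mul_mx_adj mul_mx_scalar.
have le2 : `|y 0 i - y' 0 i| <= 2.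
  have: `|((z - z') *m \adj A) 0 i| <= `|\det A| + `|\det A|.
    rewrite mulmxBl mxE [X in _ + X]mxE.
    exact: le_trans (ler_normB _ _) (lerD (zP i) (z'P i)).
  rewrite zz' mxE normrM -mulr2n -[_ *+ 2]mulr_natr ler_pM2l ?normr_gt0 //.
  by rewrite !mxE.
have := yE i; rewrite !ffunE => /(congr1 val) /=; rewrite -/y -/y'.
move: (y 0 i) (y' 0 i) le2 => a b; lia.
Qed.

(** * Squares of vectors as symmetric tensors *)

Definition leq_pairs d := [set p : 'I_d * 'I_d | (p.1 <= p.2)%N].

Lemma card_leq_pairs d : #|leq_pairs d| = (d + 'C(d, 2))%N.
Proof.
rewrite -sum1_card (eq_bigl (fun p : 'I_d * 'I_d => true && (p.1 <= p.2)%N)).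
  rewrite -(pair_big_dep xpredT (fun i j : 'I_d => (i <= j)%N) (fun _ _ => 1%N)).
  rewrite (exchange_big_dep xpredT) //= -bin2_sum big_mkord addnC.
  rewrite -[X in (_ + X)%N]card_ord -sum1_card -big_split /=.
  apply: eq_bigr => j _.
  by rewrite -(big_ord_widen d (fun=> 1%N) (ltn_ord j)) sum1_card card_ord addn1.
by case=> i j; rewrite inE.
Qed.

(* The upper triangular part of S, which determines S when S is symmetric. *)
Definition symv (F : fieldType) d (S : 'M[F]_d) : 'rV[F]_#|leq_pairs d| :=
  \row_k S (enum_val k).1 (enum_val k).2.

Lemma symv_sum (F : fieldType) d I (r : seq I) (c : I -> F)
    (S : I -> 'M[F]_d) :
  symv (\sum_(i <- r) c i *: S i) = \sum_(i <- r) c i *: symv (S i).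
Proof.
apply/rowP => k; rewrite mxE !summxE; apply: eq_bigr => i _.
by rewrite !mxE.
Qed.

Lemma symv_sum_ord (F : fieldType) d n (c : 'rV[F]_n) (S : 'I_n -> 'M[F]_d) :
  symv (\sum_i c 0 i *: S i) = c *m (\matrix_i symv (S i)).
Proof.
by rewrite symv_sum mulmx_sum_row; apply: eq_bigr => i _; rewrite rowK.
Qed.

Lemma symv_inj (F : fieldType) d (S S' : 'M[F]_d) :
  S^T = S -> S'^T = S' -> symv S = symv S' -> S = S'.
Proof.
move=> sS sS' /rowP eqS.
have le_eq (i j : 'I_d) : (i <= j)%N -> S i j = S' i j.
  move=> ij; have Kij : (i, j) \in leq_pairs d by rewrite inE.
  by have := eqS (enum_rank_in Kij (i, j)); rewrite !mxE enum_rankK_in.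
apply/matrixP => i j; have [/le_eq // | /ltnW/le_eq eqji] := leqP i j.
by rewrite -sS -sS' !mxE.
Qed.

(** Basis extension, with spanning stated dually: no nonzero functional vanishes on [X]. While the
    rank is not full, some vector of [X] lies outside the row space, since otherwise the columns of
    [cokermx W] would vanish on [X]. *)
Lemma extend_row_full (F : fieldType) k m n (W : 'M[F]_(k, n))
    (X : 'rV[F]_n -> Prop) :
  (\rank W + m)%N = n ->
  (forall y : 'cV_n, (forall x, X x -> x *m y = 0) -> y = 0) ->
  exists2 W' : 'M_(m, n), forall i, X (row i W') & row_full (W + W')%MS.
Proof.
move=> rW spanX; elim: m => [|m IHm] in k W rW *.
  exists 0; first by case.
  by rewrite /row_full addsmx0 -[X in _ == X]rW addn0.
have [x Xx xW] : exists2 x, X x & ~~ (x <= W)%MS.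
  apply: contrapT => noX.
  suff: row_full W by rewrite /row_full -[X in _ == X]rW -[X in X == _]addn0 eqn_add2l.
  rewrite -cokermx_eq0; apply/eqP/trmx_inj/row_matrixP => j.
  rewrite -tr_col trmx0 row0 (spanX (col j (cokermx W))) ?trmx0 // => x Xx.
  rewrite colE mulmxA; suff /eqP -> : x *m cokermx W == 0 by rewrite mul0mx.
  by rewrite -submxE; apply: contrapT => /negP xW; apply: noX; exists x.
have rWx : \rank (W + x)%MS = (\rank W).+1.
  apply/eqP; rewrite eqn_leq; apply/andP; split.
    rewrite (leq_trans (mxrank_adds_leqif _ _)) // -[(\rank W).+1]addn1 leq_add2l.
    exact: rank_leq_row.
  apply: rank_ltmx; rewrite ltmxE addsmxSl /=.
  by apply: contra xW; apply: submx_trans; rewrite addsmxSr.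
have [|W' XW' fullW'] := IHm _ (W + x)%MS; first by rewrite rWx addSnnS.
exists (col_mx x W' : 'M_(1 + m, n)).
  move=> i; case: (@split_ordP 1 m i) => j ->.
    have -> : row (lshift m j) (col_mx x W') = x by rewrite rowKu [j]ord1 row_id.
    exact: Xx.
  have -> : row (rshift 1 j) (col_mx x W') = row j W' by rewrite rowKd.
  exact: XW'.
rewrite -sub1mx; rewrite -sub1mx in fullW'.
apply: (submx_trans fullW'); rewrite -addsmxA addsmxS //.
by rewrite addsmxE.
Qed.

(** A combination of the squares with coefficients [c] is [T^T *m diag_mx c *m T], which is zero
    only for [c = 0]. *)
Lemma row_free_squares (F : fieldType) d (T : 'M[F]_d) : T \in unitmx ->
  row_free (\matrix_i symv ((row i T)^T *m row i T)).
Proof.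
move=> uT; apply: inj_row_free => c; rewrite -symv_sum_ord => c0.
have E : \sum_i c 0 i *: ((row i T)^T *m row i T) = T^T *m diag_mx c *m T.
  apply/matrixP => a b; rewrite summxE mul_mx_diag [RHS]mxE.
  by apply: eq_bigr => i _; rewrite !mxE big_ord1 !mxE mulrCA mulrA.
have : T^T *m diag_mx c *m T = 0.
  apply: symv_inj; rewrite ?trmx0 //; last first.
    by rewrite -E c0; apply/rowP => k; rewrite !mxE.
  by rewrite !trmx_mul trmxK tr_diag_mx mulmxA.
move=> /(congr1 (fun M => invmx T^T *m (M *m invmx T))).
rewrite mulmxK // mulKmx ?unitmx_tr // mul0mx mulmx0 => /matrixP dc0.
by apply/rowP => i; have := dc0 i i; rewrite !mxE eqxx.
Qed.

(* H is itself a combination of the squares v^T v, and tr (H v^T v) = v H v^T = 0,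
   so tr (H^2) = 0. *)
Lemma row_full_squares_inj (F : realFieldType) d n (V : 'M[F]_(n, d))
    (H : 'M[F]_d) :
  row_full (\matrix_i symv ((row i V)^T *m row i V)) -> H^T = H ->
  (forall i, row i V *m H *m (row i V)^T = 0) -> H = 0.
Proof.
move=> fullV sH VH.
have /submxP[c] := submx_full (symv H) fullV.
rewrite -symv_sum_ord => /symv_inj => defH.
have {}defH : H = \sum_i c 0 i *: ((row i V)^T *m row i V).
  apply: defH => //; rewrite linear_sum; apply: eq_bigr => i _.
  by rewrite linearZ /= trmx_mul trmxK.
have tr0 : \tr (H *m H) = 0.
  rewrite [X in _ *m X]defH mulmx_sumr raddf_sum big1 // => i _.
  by rewrite -scalemxAr [LHS]mxtraceZ mulmxA mxtrace_mulC mulmxA VH mxtrace0 mulr0.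
apply/matrixP => i j; rewrite mxE; move: tr0; rewrite /mxtrace.
have sq_ge0 a b : 0 <= H a b * H b a by rewrite -[in H b a]sH mxE -expr2 sqr_ge0.
move/eqP; rewrite psumr_eq0 => [/allP/(_ i)|a _]; last first.
  by rewrite mxE sumr_ge0.
rewrite mem_index_enum mxE => /(_ isT).
rewrite psumr_eq0 // => /allP/(_ j); rewrite mem_index_enum => /(_ isT) /=.
by rewrite -[in H j i]sH mxE -expr2 sqrf_eq0 => /eqP.
Qed.

(** * Lattices in coordinates *)

Local Notation "M ^R" := (map_mx (intr : int -> R) M) (at level 2, format "M ^R").

Definition vec_of_row d (u : 'rV[R]_d) : vec d := fun j => u 0 j.

Lemma row_of_vecK d (v : vec d) : vec_of_row (\row_j v j) = v.
Proof. by apply: funext => j; rewrite /vec_of_row mxE. Qed.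

Lemma vec_of_rowK d (u : 'rV[R]_d) : \row_j vec_of_row u j = u.
Proof. by apply/rowP => j; rewrite mxE. Qed.

Lemma vec_of_row_inj d : injective (@vec_of_row d).
Proof. by apply: (@can_inj _ _ _ (fun v => \row_j v j)) => u; apply: vec_of_rowK. Qed.

Lemma dot_vec_of_row d (u v : 'rV[R]_d) :
  dot (vec_of_row u) (vec_of_row v) = (u *m v^T) 0 0.
Proof. by rewrite mxE; apply: eq_bigr => j _; rewrite mxE. Qed.

Lemma IZR_Z_of_int (m : int) : IZR (Z_of_int m) = m%:~R.
Proof.
case: m => n /=; first by rewrite -INR_IZR_INZ INRE.
by rewrite NegzE opp_IZR -INR_IZR_INZ INRE addn1 mulrNz.
Qed.

Definition lattice_basis d (B : 'M[R]_d) (L : vec d -> Prop) :=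
  B \in unitmx /\
  forall v, L (vec_of_row v) <-> exists z : 'rV[int]_d, v = z^R *m B.

Lemma zcomb_vec_of_row d (b : 'I_d -> vec d) (z : 'rV[int]_d) :
  zcomb b (fun i => Z_of_int (z 0 i)) =
  vec_of_row (z^R *m \matrix_(i, j) b i j).
Proof.
apply: funext => j; rewrite /zcomb /vec_of_row mxE.
by apply: eq_bigr => i _; rewrite !mxE IZR_Z_of_int.
Qed.

Lemma is_latticeP d (L : vec d -> Prop) :
  is_lattice L <-> exists B, lattice_basis B L.
Proof.
split=> [[b [b_free Lb]]|[B [uB LB]]].
  exists (\matrix_(i, j) b i j); split.
    rewrite -row_free_unit; apply: inj_row_free => r r0.
    apply/rowP => i; rewrite mxE; apply: (b_free (r 0)) => j.
    move/rowP/(_ j): r0; rewrite !mxE => r0; rewrite -[RHS]r0.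
    by apply: eq_bigr => k _; rewrite mxE.
  move=> v; rewrite Lb; split=> [[z vz]|[z ->]]; last first.
    by exists (fun i => Z_of_int (z 0 i)); rewrite zcomb_vec_of_row.
  exists (\row_i int_of_Z (z i)); apply: vec_of_row_inj.
  rewrite vz -zcomb_vec_of_row; congr zcomb; apply: funext => i.
  by rewrite mxE int_of_ZK.
exists (fun i j => B i j); split.
  move=> r r0 i; have : (\row_i r i) *m B = 0.
    apply/rowP => j; rewrite !mxE -[RHS](r0 j).
    by apply: eq_bigr => k _; rewrite mxE.
  move/(congr1 (mulmx^~ (invmx B))); rewrite mulmxK // mul0mx => /rowP/(_ i).
  by rewrite !mxE.
have BE : \matrix_(i, j) B i j = B by apply/matrixP => i j; rewrite mxE.
move=> v; rewrite -(row_of_vecK v) LB; split=> [[z ->]|[z vz]].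
  by exists (fun i => Z_of_int (z 0 i)); rewrite zcomb_vec_of_row BE.
exists (\row_i int_of_Z (z i)); apply: vec_of_row_inj.
rewrite vz -[X in _ *m X]BE -zcomb_vec_of_row; congr zcomb; apply: funext => i.
by rewrite mxE int_of_ZK.
Qed.

Lemma lattice_basis_unitmx d (B : 'M[R]_d) L (U : 'M[int]_d) :
  U \in unitmx -> lattice_basis B L -> lattice_basis (U^R *m B) L.
Proof.
move=> uU [uB LB]; split.
  by rewrite unitmx_mul uB andbT unitmxE det_map_mx rmorph_unit -?unitmxE.
move=> v; rewrite LB; split=> [[z ->]|[z ->]].
  exists (z *m invmx U).
  by rewrite mulmxA -map_mxM mulmxKV.
by exists (z *m U); rewrite map_mxM mulmxA.
Qed.

(** Cramer's rule, by expansion along the replaced row. It turns maximality of a determinant into a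
    bound on coordinates. *)
Lemma cramer_row d (A : 'M[int]_d) (z : 'rV_d) i :
  \det (\matrix_a (if a == i then z else row a A)) = (z *m \adj A) 0 i.
Proof.
rewrite (expand_det_row _ i) mxE; apply: eq_bigr => j _.
rewrite !mxE eqxx; congr (_ * (_ * \det _)); apply/matrixP => a b.
by rewrite !mxE eq_sym (negPf (neq_lift _ _)) mxE.
Qed.

Lemma dot_row_gt0 d (v : 'rV[R]_d) : v != 0 -> 0 < (v *m v^T) 0 0.
Proof.
move=> v0; have sq_ge0 j : 0 <= v 0 j * v^T j 0 by rewrite mxE -expr2 sqr_ge0.
rewrite lt_def mxE sumr_ge0 // andbT.
apply: contra_neq v0 => /eqP; rewrite psumr_eq0 // => /allP v0.
apply/rowP => j; have := v0 j (mem_index_enum _).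
by rewrite !mxE -expr2 sqrf_eq0 => /eqP.
Qed.

Lemma In_map (S T : Type) (f : S -> T) s y :
  List.In y (map f s) -> exists2 x, List.In x s & y = f x.
Proof.
elim: s => //= a s IHs [<-|/IHs[x sx ->]]; first by exists a => //; left.
by exists x => //; right.
Qed.

Section Lattice.
Variables (d : nat) (L : vec d -> Prop).
Implicit Type (B : 'M[R]_d).

Lemma lattice_basis_min B v : lattice_basis B L -> min_vec L v ->
  exists z : 'rV[int]_d, v = vec_of_row (z^R *m B).
Proof.
move=> [_ LB] [Lv _]; move: Lv; rewrite -(row_of_vecK v) LB => -[z vz].
by exists z; rewrite vz.
Qed.

(** Perfection in integer coordinates: the definition is applied to [B^T *m S *m B], and [B] is then
    cancelled on both sides. *)
Lemma perfect_span B S : lattice_basis B L -> perfect L -> S^T = S ->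
  exists2 ds : seq (R * 'rV[int]_d),
    forall p, p \in ds -> min_vec L (vec_of_row (p.2^R *m B)) &
    S = \sum_(p <- ds) p.1 *: ((p.2^R)^T *m p.2^R).
Proof.
move=> LB perfL sS; have uB := LB.1.
have [|cs [csL csE]] := perfL (fun i j => (B^T *m S *m B) i j).
  move=> i j; rewrite -[in RHS](_ : (B^T *m S *m B)^T = B^T *m S *m B) ?mxE //.
  by rewrite !trmx_mul trmxK sS mulmxA.
have [ds dsL dsE] : exists2 ds : seq (R * 'rV[int]_d),
    forall p, p \in ds -> min_vec L (vec_of_row (p.2^R *m B)) &
    cs = [seq (p.1, vec_of_row (p.2^R *m B)) | p <- ds].
  elim: cs csL {csE} => [|[c v] cs IHcs] csL; first by exists nil.
  have [|ds dsL ->] := IHcs; first by move=> p cs_p; apply: csL; right.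
  have minv : min_vec L v by apply: (csL (c, v)); left.
  have [z vz] := lattice_basis_min LB minv; exists ((c, z) :: ds).
    by move=> p; rewrite inE => /predU1P[->|/dsL //]; rewrite /= -vz.
  by rewrite vz.
exists ds => //; have : B^T *m S *m B =
    \sum_(p <- ds) p.1 *: ((p.2^R *m B)^T *m (p.2^R *m B)).
  apply/matrixP => i j; rewrite csE dsE big_map summxE.
  apply: eq_bigr => p _; rewrite !mxE big_ord1 mxE mulrA.
  by rewrite /vec_of_row.
move/(congr1 (fun M => invmx B^T *m (M *m invmx B))).
rewrite mulmxK // mulKmx ?unitmx_tr // => ->.
rewrite mulmx_suml mulmx_sumr; apply: eq_bigr => p _.
rewrite -scalemxAl -scalemxAr; congr (_ *: _).
by rewrite -mulmxA mulmxK // trmx_mul mulmxA mulKmx ?unitmx_tr.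
Qed.

(** Writing the identity matrix as a combination of squares of minimal vectors makes [y^T *m y] a
    combination of squares of the numbers [z^R *m y]. *)
Lemma perfect_span_rows B (y : 'cV[R]_d) : lattice_basis B L -> perfect L ->
  (forall z : 'rV[int]_d, min_vec L (vec_of_row (z^R *m B)) -> z^R *m y = 0) ->
  y = 0.
Proof.
move=> LB perfL y0; have [ds dsL dsE] := perfect_span LB perfL (trmx1 _ _).
have : (y^T *m y^T^T) 0 0 = 0.
  rewrite trmxK -[y^T]mulmx1 dsE mulmx_sumr mulmx_suml big_seq big1 ?mxE //.
  move=> p /dsL/y0 py; rewrite -scalemxAr -scalemxAl -!mulmxA py.
  by rewrite !mulmx0 scaler0.
move=> yy; apply: trmx_inj; rewrite trmx0; apply/eqP; apply: contraT.
by move/dot_row_gt0; rewrite yy ltxx.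
Qed.

Lemma perfect_span_squares B (y : 'cV[R]_#|leq_pairs d|) :
  lattice_basis B L -> perfect L ->
  (forall z : 'rV[int]_d, min_vec L (vec_of_row (z^R *m B)) ->
     symv ((z^R)^T *m z^R) *m y = 0) ->
  y = 0.
Proof.
move=> LB perfL y0; apply/colP => k; rewrite [RHS]mxE.
(* The disjunction, unlike a sum of two elementary matrices, gives 1 on the diagonal too, so
   [symv S] is always a unit vector. *)
pose S : 'M[R]_d := \matrix_(i, j)
  (((i, j) == enum_val k) || ((j, i) == enum_val k))%:R.
have sS : S^T = S by apply/matrixP => i j; rewrite !mxE orbC.
have symvS : symv S = delta_mx 0 k.
  apply/rowP => l; rewrite !mxE eqxx /= -(inj_eq enum_val_inj).
  have := enum_valP l; have := enum_valP k; rewrite !inE.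
  case: (enum_val l) (enum_val k) => [i j] [a b] /= ab ij.
  rewrite !xpair_eqE; congr (nat_of_bool _)%:R; apply/orb_idr.
  case/andP=> /eqP ja /eqP ib.
  have ij_eq : i = j by apply/val_inj/anti_leq; rewrite ij /= ja ib.
  by rewrite -ib ij_eq ja !eqxx.
have [ds dsL dsE] := perfect_span LB perfL sS.
have : symv S *m y = 0.
  rewrite dsE symv_sum mulmx_suml big_seq big1 // => p /dsL/y0 py.
  by rewrite -scalemxAl py scaler0.
by rewrite symvS -rowE => /rowP/(_ 0); rewrite !mxE.
Qed.

Lemma vsub_vec_of_row (u v : 'rV[R]_d) :
  vsub (vec_of_row u) (vec_of_row v) = vec_of_row (u - v).
Proof. by apply: funext => j; rewrite /vsub /vec_of_row !mxE. Qed.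

(** The rows of [A^R *m B] generate a well-rounded sublattice of index [|det A|], to which the bound
    applies. *)
Lemma det_min_vec_le B (A : 'M[int]_d) I : (0 < d)%N -> index_bound d I ->
  lattice_basis B L ->
  (forall i, min_vec L (vec_of_row ((row i A)^R *m B))) ->
  \det A != 0 -> (`|\det A| <= I)%N.
Proof.
move=> d0 hI LB minA A0; have [uB LBv] := LB.
pose L' v := exists z : 'rV[int]_d, v = vec_of_row (z^R *m (A^R *m B)).
have uAB : A^R *m B \in unitmx.
  by rewrite unitmx_mul uB unitmxE det_map_mx unitfE intr_eq0 A0.
have L'L v : L' v -> L v.
  by case=> z ->; apply/LBv; exists (z *m A); rewrite map_mxM mulmxA.
have L'A i : L' (vec_of_row ((row i A)^R *m B)).
  by exists (delta_mx 0 i); rewrite mulmxA -map_mxM -rowE.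
have minA' i : min_vec L' (vec_of_row ((row i A)^R *m B)).
  by have [_ [vn0 minv]] := minA i; do 2?[split] => // w /L'L; apply: minv.
apply: (hI L L') => //.
- by apply/is_latticeP; exists B.
- apply/is_latticeP; exists (A^R *m B); split=> // v.
  by split=> [[z /vec_of_row_inj]|[z ->]]; exists z.
- move=> x; pose c := (\row_j x j) *m invmx (A^R *m B).
  exists [seq (c 0 i, vec_of_row ((row i A)^R *m B)) | i <- index_enum 'I_d].
  split=> [p p_cs|j]; first by have [i _ ->] := In_map p_cs; apply: minA'.
  rewrite big_map /=.
  rewrite -[x]row_of_vecK -[\row_j x j](mulmxKV uAB) -/c /vec_of_row mxE.
  by apply: eq_bigr => i _; rewrite map_row -row_mul [row i _ _ _]mxE.
(* The first row of [A] gives a vector of [L'] that is minimal in [L]; [v] is no longer than it,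
   hence minimal in [L]. *)
- move=> v [L'v [v0 minv]]; split; [exact: L'L | split=> // w Lw w0].
  have [_ [i0 mini]] := minA (Ordinal d0).
  apply: Rle_trans (mini _ Lw w0); exact: minv.
have [reps repsP] := row_lattice_reps A0.
exists (fun k => vec_of_row ((reps k)^R *m B)); split.
  by move=> k; apply/LBv; exists (reps k).
move=> v; rewrite -(row_of_vecK v) => /LBv[z ->].
have L'P k : L' (vsub (vec_of_row (z^R *m B)) (vec_of_row ((reps k)^R *m B)))
    <-> exists y, z - reps k = y *m A.
  rewrite vsub_vec_of_row -mulmxBl -map_mxB; split=> [[y yE]|[y ->]]; exists y.
    have /(congr1 (mulmx^~ (invmx B))) := vec_of_row_inj yE.
    rewrite mulmxA -map_mxM !mulmxK // => /matrixP zE.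
    by apply/matrixP => i j; have := zE i j; rewrite !mxE => /intr_inj.
  by rewrite map_mxM mulmxA.
have [k [kP kU]] := repsP z.
by exists k; split=> [|k' /L'P/kU //]; apply/L'P.
Qed.

End Lattice.

(** * Perfect lattices up to similarity *)

Definition min_rows d n (L : vec d -> Prop) (B : 'M[R]_d) (V : 'M[int]_(n, d)) :=
  forall i, min_vec L (vec_of_row ((row i V)^R *m B)).

Definition squares d n (V : 'M[int]_(n, d)) : 'M[R]_(n, #|leq_pairs d|) :=
  \matrix_i symv ((row i V^R)^T *m row i V^R).

Lemma row_squares d n (V : 'M[int]_(n, d)) i :
  row i (squares V) = symv (((row i V)^R)^T *m (row i V)^R).
Proof. by rewrite rowK -map_row. Qed.

Lemma squares_col_mx d m n (V : 'M[int]_(m, d)) (W : 'M[int]_(n, d)) :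
  squares (col_mx V W) = col_mx (squares V) (squares W).
Proof.
apply/row_matrixP => i; case: (split_ordP i) => j ->.
  by rewrite rowKu !row_squares rowKu.
by rewrite rowKd !row_squares rowKd.
Qed.

Lemma min_rows_col_mx d m n (L : vec d -> Prop) B
    (V : 'M[int]_(m, d)) (W : 'M[int]_(n, d)) :
  min_rows L B V -> min_rows L B W -> min_rows L B (col_mx V W).
Proof.
move=> minV minW i; case: (split_ordP i) => j ->; first by rewrite rowKu.
by rewrite rowKd.
Qed.

Lemma min_vec_dot d (L : vec d -> Prop) u v :
  min_vec L u -> min_vec L v -> dot u u = dot v v.
Proof.
by move=> [Lu [u0 minu]] [Lv [v0 minv]]; apply: Rle_antisym; [apply: minu|apply: minv].
Qed.

(** Scaled by the minimal norms, the two Gram matrices differ by a symmetric form vanishing on all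
    rows of [V]. The squares of these rows span, so the form is zero; proportional Gram matrices
    give a similarity. *)
Lemma similar_of_common_min_rows d n (L1 L2 : vec d -> Prop) B1 B2
    (V : 'M[int]_(n, d)) : (0 < n)%N ->
  lattice_basis B1 L1 -> lattice_basis B2 L2 ->
  min_rows L1 B1 V -> min_rows L2 B2 V -> row_full (squares V) ->
  similar L1 L2.
Proof.
move=> n0 [uB1 LB1] [uB2 LB2] min1 min2 fullV.
pose v B i := (row i V)^R *m B : 'rV[R]_d.
pose m B := (v B (Ordinal n0) *m (v B (Ordinal n0))^T) 0 0.
have norm_eq L B i : min_rows L B V -> v B i *m (v B i)^T = (m B)%:M.
  move=> minV; rewrite [LHS]mx11_scalar -!dot_vec_of_row /m -dot_vec_of_row.
  by rewrite (min_vec_dot (minV i) (minV (Ordinal n0))).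
have m_gt0 L B : min_rows L B V -> 0 < m B.
  move=> minV; apply: dot_row_gt0; have [_ [vn0 _]] := minV (Ordinal n0).
  apply: contra_not_neq vn0; rewrite /v => ->.
  by apply: funext => j; rewrite /vec_of_row mxE.
have m1_gt0 := m_gt0 _ _ min1; have m2_gt0 := m_gt0 _ _ min2.
have gram : m B2 *: (B1 *m B1^T) = m B1 *: (B2 *m B2^T).
  apply/eqP; rewrite -subr_eq0; apply/eqP.
  apply: (row_full_squares_inj fullV) => [|i].
    by rewrite linearB !linearZ /= !trmx_mul !trmxK.
  rewrite -map_row mulmxBr mulmxBl -!scalemxAr -!scalemxAl.
  have vv B : (row i V)^R *m (B *m B^T) *m ((row i V)^R)^T = v B i *m (v B i)^T.
    by rewrite trmx_mul !mulmxA.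
  rewrite !vv (norm_eq _ _ i min1) (norm_eq _ _ i min2) !scale_scalar_mx.
  by rewrite mulrC subrr.
(* The ratio of the minimal lengths; [O] below carries [B1] to [B2] divided by [c], and is
   orthogonal by [gram]. *)
pose c := Num.sqrt (m B2 / m B1).
have c_gt0 : 0 < c by rewrite sqrtr_gt0 divr_gt0.
have c2 : c * c = m B2 / m B1 by rewrite -expr2 sqr_sqrtr // ltW // divr_gt0.
pose O := c^-1 *: (invmx B1 *m B2).
have cO u : c *: (u *m B1 *m O) = u *m B2.
  rewrite -scalemxAr scalerA mulfV ?gt_eqF // scale1r -mulmxA.
  by rewrite (mulmxA B1) mulmxV // mul1mx.
have OO : O *m O^T = 1%:M.
  rewrite linearZ /= trmx_mul -scalemxAl -scalemxAr scalerA -invfM c2.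
  rewrite mulmxA -(mulmxA (invmx B1)).
  have -> : B2 *m B2^T = (m B2 / m B1) *: (B1 *m B1^T).
    by rewrite mulrC -scalerA gram scalerA mulVf ?gt_eqF // scale1r.
  rewrite -scalemxAr -scalemxAl scalerA mulVf ?gt_eqF ?divr_gt0 // scale1r.
  by rewrite mulmxA mulVmx // mul1mx trmx_inv mulmxV // unitmx_tr.
exists c, (fun i j => O i j); split; first exact/RltP.
split=> [i j|w].
  move/matrixP/(_ i j): OO; rewrite !mxE => OO.
  transitivity ((i == j)%:R : R); last by case: (i == j).
  by rewrite -OO; apply: eq_bigr => k _; rewrite [O^T k j]mxE.
have scaled (u : 'rV[R]_d) : (fun j => c * \big[Rplus/0]_(i < d)
    (vec_of_row u i * O i j)) = vec_of_row (c *: (u *m O)).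
  by apply: funext => j; rewrite /vec_of_row mxE [(u *m O) _ _]mxE.
rewrite -(row_of_vecK w) LB2; split=> [[z ->]|[u [Lu wE]]].
  exists (vec_of_row (z^R *m B1)); split; first by apply/LB1; exists z.
  by rewrite scaled cO.
move: Lu; rewrite -(row_of_vecK u) LB1 => -[z uz]; exists z.
have {}uz : u = vec_of_row (z^R *m B1) by rewrite -uz row_of_vecK.
by apply: vec_of_row_inj; rewrite wE uz scaled cO.
Qed.

(** The bound on [row i Z *m \adj T] says, without denominators, that the coordinates of the rows of
    [Z] with respect to those of [T] lie in [-1, 1]. *)
Definition reduced_form d I (L : vec d -> Prop) B (T : 'M[int]_d)
    (Z : 'M[int]_('C(d, 2), d)) :=
  [/\ lattice_basis B L, (0 < `|\det T| <= I)%N,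
      min_rows L B T /\ min_rows L B Z,
      forall i k, `|(row i Z *m \adj T) 0 k| <= `|\det T|
    & row_full (squares (col_mx T Z))].

(** The full-rank matrix of squares is square, so its rows are independent. Hence [Z] yields exactly
    ['C(d, 2)] codes. *)
Lemma reduced_form_row_inj d I (L : vec d -> Prop) B T Z :
  reduced_form I L B T Z -> injective (fun i => row i Z).
Proof.
case=> _ _ _ _ full i j ij.
have free : row_free (squares (col_mx T Z)).
  by rewrite /row_free (eqP full) card_leq_pairs.
apply: (@rshift_inj d); apply/eqP.
have : row (rshift d i) (squares (col_mx T Z)) =
    row (rshift d j) (squares (col_mx T Z)) by rewrite !row_squares !rowKd ij.
rewrite !rowE => /(row_free_inj free)/rowP/(_ (rshift d i)).
rewrite !mxE !eqxx /=; case: eqP => // _ /eqP.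
by rewrite oner_eq0.
Qed.

Lemma perfect_reduced_form d I (s : seq 'M[int]_d) L :
  (0 < d)%N -> index_bound d I ->
  (forall A, (0 < `|\det A| <= I)%N ->
     exists2 U, U \in unitmx & A *m U \in s) ->
  is_lattice L -> perfect L ->
  exists B T Z, T \in s /\ reduced_form I L B T Z.
Proof.
move=> d0 hI s_cover /is_latticeP[B0 LB0] perfL.
(* The basis is quantified along with [A], so that maximality survives the later change of basis. *)
pose P n := `[< exists B (A : 'M[int]_d),
  [/\ lattice_basis B L, min_rows L B A, \det A != 0 & `|\det A|%N = n] >].
have exP : exists n, P n.
  pose X x := exists2 z : 'rV[int]_d, x = z^R &
    min_vec L (vec_of_row (z^R *m B0)).
  have [|y y0|W XW fullW] := @extend_row_full _ 0 d d (0 : 'M[R]_(0, d)) X.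
  - by rewrite mxrank0.
  - by apply: (perfect_span_rows LB0 perfL) => z minz; apply: y0; exists z.
  have /choice[z zP] i : exists z, row i W = z^R /\
      min_vec L (vec_of_row (z^R *m B0)).
    by have [z] := XW i; exists z.
  pose A := \matrix_i z i.
  have AW : A^R = W.
    by apply/row_matrixP => i; rewrite -map_row rowK (zP i).1.
  exists `|\det A|%N; apply/asboolP; exists B0, A; split=> //.
    by move=> i; rewrite rowK; exact: (zP i).2.
  have : \det A^R != 0.
    rewrite -unitfE -unitmxE AW -row_full_unit.
    by rewrite /row_full adds0mx in fullW.
  by rewrite det_map_mx intr_eq0.
have P_le n : P n -> (n <= I)%N.
  move=> /asboolP[B [A [LB minA A0 <-]]].
  exact: (det_min_vec_le d0 hI LB minA A0).
case: (ex_maxnP exP P_le) => n /asboolP[B1 [A [LB1 minA A0 <-]]] maxn {n}.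
have [|U uU sT] := s_cover A.
  by rewrite absz_gt0 A0; exact: (det_min_vec_le d0 hI LB1 minA A0).
(* The rows of [T] in the basis [B] are the same vectors as the rows of [A] in [B1]. *)
pose T := A *m U; pose B := (invmx U)^R *m B1.
have LB : lattice_basis B L by apply: lattice_basis_unitmx; rewrite ?unitmx_inv.
have detT : `|\det T|%N = `|\det A|%N.
  by rewrite det_mulmx abszM (absz_det_unitmx uU) muln1.
have T0 : \det T != 0 by rewrite -absz_eq0 detT absz_eq0.
have minT : min_rows L B T.
  move=> i; rewrite mulmxA -map_mxM -row_mul mulmxK //; exact: minA.
have uT : T^R \in unitmx by rewrite unitmxE det_map_mx unitfE intr_eq0.
pose X x := exists2 z : 'rV[int]_d, x = symv ((z^R)^T *m z^R) &
    min_vec L (vec_of_row (z^R *m B)).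
have [||W XW fullW] := @extend_row_full _ d 'C(d, 2) _ (squares T) X.
- by rewrite (eqP (row_free_squares uT)) card_leq_pairs.
- move=> y y0; apply: (perfect_span_squares LB perfL) => z minz.
  by apply: y0; exists z.
have /choice[z zP] i : exists z : 'rV[int]_d,
    row i W = symv ((z^R)^T *m z^R) /\ min_vec L (vec_of_row (z^R *m B)).
  by have [z] := XW i; exists z.
pose Z := \matrix_i z i.
have ZW : squares Z = W.
  by apply/row_matrixP => i; rewrite row_squares rowK (zP i).1.
have minZ : min_rows L B Z by move=> i; rewrite rowK; exact: (zP i).2.
exists B, T, Z; split=> //; split=> //; first 1 last.
(* [T'] is [T] with one row replaced by a row of [Z]; all its rows are still minimal, so a nonzero
   determinant competes in the maximum. *)
- move=> i k; rewrite -cramer_row; set T' := \matrix_a _.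
  have [->|T'0] := eqVneq (\det T') 0; first by rewrite normr0.
  rewrite -!abszE lez_nat detT; apply: maxn; apply/asboolP.
  exists B, T'; split=> // a; rewrite rowK.
  by case: (a == k); [exact: minZ | exact: minT].
- by rewrite squares_col_mx ZW -sub1mx -addsmxE sub1mx.
by rewrite absz_gt0 T0; exact: (det_min_vec_le d0 hI LB minT T0).
Qed.

(** Pigeonhole for a relation, as the code of a lattice depends on choices. Codes picked one by one
    are distinct, because a shared code would give [sim]. *)
Lemma size_le_card_codes (T : Type) (C : finType) (code : T -> C -> Prop)
    (sim : T -> T -> Prop) (s : seq T) :
  (forall x, List.In x s -> exists c, code x c) ->
  (forall x y c, code x c -> code y c -> sim x y) ->
  List.ForallOrdPairs (fun x y => ~ sim x y) s -> (size s <= #|C|)%N.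
Proof.
move=> coded sim_code dist.
suff [cs [<- ucs _]] : exists cs : seq C, [/\ size cs = size s, uniq cs &
    forall c, c \in cs -> exists2 x, List.In x s & code x c].
  by rewrite -(card_uniqP ucs) max_card.
elim: dist coded => {s} [|x s /List.Forall_forall distx _ IHs] coded.
  by exists nil.
have [|cs [sz ucs csP]] := IHs; first by move=> y sy; apply: coded; right.
have [|c xc] := coded x; first by left.
exists (c :: cs); split=> /= [||c']; first by rewrite sz.
  rewrite ucs andbT; apply/negP => /csP[y sy yc].
  by apply: (distx y sy); apply: sim_code xc yc.
rewrite inE => /predU1P[->|/csP[y sy yc]]; first by exists x => //; left.
by exists y => //; right.
Qed.

(* Any family of pairwise non-similar d-dimensional perfect lattices has at
   most I_d^(d+1) * C(3^d I_d, C(d,2)) members. *)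
Theorem theorem10p1 (d Id : nat) (hd : (2 <= d)%N) (hI : is_I d Id)
    (Ls : seq (vec d -> Prop))
    (hperf : forall L, List.In L Ls -> is_lattice L /\ perfect L)
    (hdist : List.ForallOrdPairs (fun L1 L2 => ~ similar L1 L2) Ls) :
  (size Ls <= Id ^ d.+1 * 'C(3 ^ d * Id, 'C(d, 2)))%N.
Proof.
have [hIb _] := hI; have d0 : (0 < d)%N by apply: leq_trans hd.
have [s sizes s_cover] := hermite_cover d Id.
have normal L : List.In L Ls -> _ := fun Ls_L =>
  perfect_reduced_form d0 hIb s_cover (hperf _ Ls_L).1 (hperf _ Ls_L).2.
pose F : finType := ('I_Id * {ffun 'I_d -> 'I_3})%type.
have cardF : #|F| = (3 ^ d * Id)%N.
  by rewrite card_prod card_ord card_ffun !card_ord mulnC.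
(* For [Id = 0] no reduced form exists, so [Ls] is empty; otherwise [F] has an element to serve as a
   default. *)
case: (posnP Id) => [Id0|Id_gt0].
  case: Ls hperf hdist normal => [//|L Ls] _ _ /(_ L (or_introl erefl)).
  by move=> [B [T [Z [_ [_ /andP[T0]]]]]]; rewrite leqNgt Id0 T0.
(* The coding is fixed once for each [T], so lattices sharing [T] have comparable codes. *)
have /choice[phi phiP] (T : 'M[int]_d) : exists phi : 'rV[int]_d -> F,
    (0 < `|\det T| <= Id)%N ->
    {in [pred z | [forall i, `|(z *m \adj T) 0 i| <= `|\det T|]] &,
      injective phi}.
  have [T_ok|_] := boolP (0 < `|\det T| <= Id)%N; last first.
    by exists (fun=> (Ordinal Id_gt0, [ffun=> ord0])).
  by have [f fP] := parallelepiped_code T_ok; exists f.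
have phi_inj L1 L2 B1 B2 T Z1 Z2 i j : reduced_form Id L1 B1 T Z1 ->
    reduced_form Id L2 B2 T Z2 ->
    phi T (row i Z1) = phi T (row j Z2) -> row i Z1 = row j Z2.
  move=> [_ T_ok _ bound1 _] [_ _ _ bound2 _].
  by apply: (phiP T T_ok); rewrite inE; apply/forallP.
pose D := [set D : {set F} | #|D| == 'C(d, 2)].
pose codeset T Z := [set phi T (row i Z) | i : 'I_('C(d, 2))].
pose code L (c : 'I_(Id ^ d) * {D0 | D0 \in D}) := exists B Z,
  reduced_form Id L B (nth 0 s c.1) Z /\ val c.2 = codeset (nth 0 s c.1) Z.
have code_ex L : List.In L Ls -> exists c, code L c.
  move=> /normal[B [T [Z [sT redZ]]]].
  have DZ : codeset T Z \in D.
    rewrite inE card_imset ?card_ord // => i j /(phi_inj _ _ _ _ _ _ _ _ _ redZ redZ).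
    exact: (reduced_form_row_inj redZ).
  have iT : (index T s < Id ^ d)%N by rewrite -sizes index_mem.
  by exists (Ordinal iT, exist (fun D0 => D0 \in D) _ DZ), B, Z; rewrite /= nth_index.
have code_similar L1 L2 c : code L1 c -> code L2 c -> similar L1 L2.
  move=> [B1 [Z1 [red1 c1]]] [B2 [Z2 [red2 c2]]].
  have [LB1 _ [minT1 minZ1] _ full] := red1.
  have [LB2 _ [minT2 minZ2] _ _] := red2.
  (* Equal code sets make every row of [Z1] a row of [Z2], so the rows of [T] and [Z1] are minimal
     for both lattices. *)
  apply: (similar_of_common_min_rows _ LB1 LB2 _ _ full).
  - by rewrite addn_gt0 d0.
  - exact: min_rows_col_mx.
  apply: min_rows_col_mx => // i.
  have : phi (nth 0 s c.1) (row i Z1) \in codeset (nth 0 s c.1) Z2.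
    by rewrite -c2 c1 imset_f.
  by case/imsetP => j _ /(phi_inj _ _ _ _ _ _ _ _ _ red1 red2) ->.
apply: leq_trans (size_le_card_codes code_ex code_similar hdist) _.
(* The codes contribute only [Id ^ d]; positivity of [Id] raises the exponent to [d.+1]. *)
rewrite card_prod card_ord card_sig card_draws cardF leq_mul2r.
by rewrite leq_pexp2l ?orbT.
Qed.
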